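(* Assume that $\lambda>\lambda_{\text{thres}}=\frac{\sqrt{mgR^3I_3\alpha}\,(1+\alpha)^2}{\sqrt{1+\alpha-\gamma}}$. (i) For every sufficiently small $\epsilon>0$ there is $\delta_{-}(\epsilon,\lambda)>0$, being a positive solution $\delta$ of the equation $$\alpha(1-\alpha)\gamma\lambda\delta+\alpha\delta^2+\frac{\delta^2}{\epsilon^2}(1-\epsilon)(1+\alpha)^2=\alpha^2\gamma^2\lambda^2-\frac{\beta}{2}(2-\epsilon)^2(1+\alpha)^2,$$ such that for every positive $\delta<\delta_{-}(\epsilon,\lambda)$ the potential $z\mapsto V(z,D,\lambda)$ has a minimum $z_{\min}$ in the interval $[-1,-1+\epsilon]$ for $D=D_1\pm\frac{\delta}{R(1+\alpha)\sqrt{\gamma+\alpha^2-1}}$ (for either choice of sign). (ii) For every sufficiently small $\epsilon>0$ there is $\delta_{+}(\epsilon,\lambda)=\min\{\delta_1,\delta_2\}>0$, where $\delta_1=\gamma(1+\alpha)\lambda$ and $\delta_2$ is the positive solution $\delta$ of the equation $$\frac{\delta^2}{\epsilon^2}(1-\epsilon)(1-\alpha)^2+\alpha\gamma\lambda\delta(1+\alpha)-\alpha\delta^2=\alpha^2\gamma^2\lambda^2+\frac{\beta}{2}(2-\epsilon)^2(1-\alpha)^2,$$ such that for every positive $\delta<\delta_{+}(\epsilon,\lambda)$ the potential $z\mapsto V(z,D,\lambda)$ has a minimum $z_{\min}$ in the interval $[1-\epsilon,1]$ for $D=D_0\mp\frac{\delta}{R(1-\alpha)\sqrt{\gamma+\alpha^2-1}}$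 (for either choice of sign).
   Context: The constants $m,g,R,I_1,I_3$ are positive real numbers, $0<\alpha<1$, $\gamma=I_1/I_3$, and it is assumed that $1-\alpha^2<\gamma<1$ and that $\sigma:=mR^2/I_3$ satisfies $\sigma=\frac{1-\gamma}{\gamma+\alpha^2-1}$. The effective potential is, for $z\in(-1,1)$ and real $D,\lambda$, $$V(z,D,\lambda)=mgR(1-\alpha z)+\frac{\big(\lambda(\alpha-(1-\gamma)z)+RD\sqrt{\gamma+\alpha^2-1}\,(\alpha-z)\big)^2}{2I_3R^2\gamma^2(\gamma+\alpha^2-1)(1-z^2)}+\frac{R^2D^2(\gamma+\alpha^2-1)-(1-\gamma)\lambda^2}{2R^2I_1(\gamma+\alpha^2-1)}.$$ Further, $$D_0=\frac{\lambda}{R(1-\alpha)}\frac{\alpha-1+\gamma}{\sqrt{\gamma+\alpha^2-1}},\qquad D_1=-\frac{\lambda}{R(1+\alpha)}\frac{\alpha+1-\gamma}{\sqrt{\gamma+\alpha^2-1}},\qquad \beta=2mgR^3\alpha I_3\gamma^2(\gamma+\alpha^2-1).$$ ''For every sufficiently small $\epsilon>0$'' means: there is $\epsilon_0\in(0,1)$ (which may depend on the fixed parameters) such that the assertion holds for all $0<\epsilon<\epsilon_0$. *)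

(* Defs.v *)
From Stdlib Require Import Reals.
Local Open Scope R_scope.

(* [f], regarded as a function on the open interval (a, b) only, attains its
   minimum over (a, b) at [z]. *)
Definition is_minimum_on (f : R -> R) (a b z : R) : Prop :=
  a < z < b /\ forall w, a < w < b -> f z <= f w.

(* [r] is the radius and [gamma] stands for [I1 / I3]; the potential is
   meaningful only for -1 < z < 1. *)

Definition V (m g r I1 I3 alpha gamma : R) (z D lambda : R) : R :=
  m * g * r * (1 - alpha * z)
  + (lambda * (alpha - (1 - gamma) * z)
     + r * D * sqrt (gamma + alpha ^ 2 - 1) * (alpha - z)) ^ 2
    / (2 * I3 * r ^ 2 * gamma ^ 2 * (gamma + alpha ^ 2 - 1) * (1 - z ^ 2))
  + (r ^ 2 * D ^ 2 * (gamma + alpha ^ 2 - 1) - (1 - gamma) * lambda ^ 2)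
    / (2 * r ^ 2 * I1 * (gamma + alpha ^ 2 - 1)).

Definition D0 (r alpha gamma lambda : R) : R :=
  lambda / (r * (1 - alpha))
  * ((alpha - 1 + gamma) / sqrt (gamma + alpha ^ 2 - 1)).

Definition D1 (r alpha gamma lambda : R) : R :=
  - (lambda / (r * (1 + alpha))
     * ((alpha + 1 - gamma) / sqrt (gamma + alpha ^ 2 - 1))).

Definition beta (m g r I3 alpha gamma : R) : R :=
  2 * m * g * r ^ 3 * alpha * I3 * gamma ^ 2 * (gamma + alpha ^ 2 - 1).

Definition lambda_thres (m g r I3 alpha gamma : R) : R :=
  sqrt (m * g * r ^ 3 * I3 * alpha) * (1 + alpha) ^ 2
  / sqrt (1 + alpha - gamma).

(* Main.v *)
(* The numerator of the potential is the square of an affine function of [z]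
   with values [p] at 1 and [q] at -1, so up to a positive factor and an additive
   constant the potential is
     - beta z + (p^2 / 2) / (1 - z) + (q^2 / 2) / (1 + z),
   which is convex on (-1, 1).  Its derivative times 2 (1 - z^2)^2 is the
   polynomial [slope], and a root of [slope] is a global minimum.  In part (i)
   q = +-delta, in part (ii) p = +-delta; the two equations of the
   statement say that [slope] vanishes at -1 + eps, resp. 1 - eps, for the less
   favourable sign, and the intermediate value theorem provides the root.
   Positivity of the right-hand side of the first equation is where the threshold
   enters: with kappa = gamma + alpha^2 - 1 one has
   kappa + (1 + alpha - gamma) = alpha (1 + alpha), and AM-GM gives
   4 kappa (1 + alpha - gamma) <= alpha^2 (1 + alpha)^2. *)
Require Import Defs.
From Stdlib Require Import Reals Lra.
Local Open Scope R_scope.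

(** * Quadratic equations in [delta]: existence, monotonicity and uniqueness of the positive root *)

Lemma pos_quadratic_root (A B C : R) :
  0 < A -> 0 <= B -> 0 < C -> exists x, 0 < x /\ A * x ^ 2 + B * x = C.
Proof.
intros hA hB hC.
assert (hAC : 0 < A * C) by (apply Rmult_lt_0_compat; assumption).
set (d := sqrt (B ^ 2 + 4 * (A * C))).
assert (hd : d * d = B ^ 2 + 4 * (A * C)) by (apply sqrt_sqrt; nra).
assert (hd0 : 0 <= d) by apply sqrt_pos.
exists ((d - B) / (2 * A)); split.
- apply Rdiv_lt_0_compat; nra.
- replace (A * ((d - B) / (2 * A)) ^ 2 + B * ((d - B) / (2 * A)))
    with ((d * d - B ^ 2) / (4 * A)) by (field; lra).
  rewrite hd; field; lra.
Qed.

(** This turns [delta] being below the root into an inequality between the two sides of the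
    equation, and it gives uniqueness of the positive root. *)
Lemma pos_quadratic_incr (A B x y : R) :
  0 < A -> 0 <= B -> 0 < x < y -> A * x ^ 2 + B * x < A * y ^ 2 + B * y.
Proof.
intros hA hB [hx hxy].
assert (x ^ 2 < y ^ 2) by nra.
assert (A * x ^ 2 < A * y ^ 2) by (apply Rmult_lt_compat_l; assumption).
assert (B * x <= B * y) by (apply Rmult_le_compat_l; lra).
lra.
Qed.

Lemma pos_quadratic_inj (A B x y : R) :
  0 < A -> 0 <= B -> 0 < x -> 0 < y ->
  A * x ^ 2 + B * x = A * y ^ 2 + B * y -> x = y.
Proof.
intros hA hB hx hy e.
destruct (Rtotal_order x y) as [h | [h | h]]; [| exact h |].
- pose proof (pos_quadratic_incr A B x y hA hB (conj hx h)); lra.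
- pose proof (pos_quadratic_incr A B y x hA hB (conj hy h)); lra.
Qed.

(** * Roots of [slope] near the endpoints *)

Definition slope (b p q z : R) : R :=
  p ^ 2 * (1 + z) ^ 2 - q ^ 2 * (1 - z) ^ 2 - 2 * b * (1 - z ^ 2) ^ 2.

Lemma slope_continuity (b p q : R) : continuity (slope b p q).
Proof. unfold slope; reg. Qed.

(** At -1 only the middle term survives and [slope] is -4 q^2 < 0, which gives the sign change and
    also keeps the root off -1, where the potential is singular. *)
Lemma slope_root_left (b p q e : R) :
  0 < e < 1 -> 0 < q ^ 2 -> 0 <= slope b p q (-1 + e) ->
  exists z, -1 < z <= -1 + e /\ slope b p q z = 0.
Proof.
intros he hq h.
(* [IVT] asks for strict signs at both ends, so a zero at -1 + e is split off first. *)
destruct h as [h | h]; [| exists (-1 + e); split; [lra | now symmetry]].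
destruct (IVT (slope b p q) (-1) (-1 + e)) as [z [hz e0]];
  [apply slope_continuity | lra | unfold slope; nra | exact h |].
exists z; split; [| exact e0].
split; [| lra].
destruct (Rle_lt_or_eq_dec (-1) z (proj1 hz)) as [hlt | heq]; [exact hlt |].
subst z; unfold slope in e0; nra.
Qed.

Lemma slope_root_right (b p q e : R) :
  0 < e < 1 -> 0 < p ^ 2 -> slope b p q (1 - e) <= 0 ->
  exists z, 1 - e <= z < 1 /\ slope b p q z = 0.
Proof.
intros he hp h.
destruct h as [h | h]; [| exists (1 - e); split; [lra | exact h]].
destruct (IVT (slope b p q) (1 - e) 1) as [z [hz e0]];
  [apply slope_continuity | lra | exact h | unfold slope; nra |].
exists z; split; [| exact e0].
split; [lra |].
destruct (Rle_lt_or_eq_dec z 1 (proj2 hz)) as [hlt | heq]; [exact hlt |].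
subst z; unfold slope in e0; nra.
Qed.

(** * The reduced potential and its minimum *)

Definition reduced (b p q z : R) : R :=
  - b * z + ((p * (1 + z) + q * (1 - z)) / 2) ^ 2 / (1 - z ^ 2).

Lemma reduced_min (b p q z w : R) :
  -1 < z < 1 -> -1 < w < 1 -> slope b p q z = 0 ->
  reduced b p q z <= reduced b p q w.
Proof.
intros hz hw h.
(* Exact first-order expansion at z, from 1/(1-w) - 1/(1-z) - (w-z)/(1-z)^2 = (w-z)^2/((1-w)(1-z)^2)
   and its mirror image. The remainders are nonnegative, which is convexity without second
   derivatives. *)
assert (e : reduced b p q w - reduced b p q z =
  p ^ 2 / 2 * ((w - z) ^ 2 / ((1 - w) * (1 - z) ^ 2))
  + q ^ 2 / 2 * ((w - z) ^ 2 / ((1 + w) * (1 + z) ^ 2))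
  + slope b p q z / (2 * (1 - z ^ 2) ^ 2) * (w - z)).
{ unfold reduced, slope; field; repeat split; nra. }
rewrite h in e.
assert (hp : 0 <= (w - z) ^ 2 / ((1 - w) * (1 - z) ^ 2)).
{ apply Rle_mult_inv_pos; [apply pow2_ge_0 |].
  apply Rmult_lt_0_compat; [| apply pow_lt]; lra. }
assert (hq : 0 <= (w - z) ^ 2 / ((1 + w) * (1 + z) ^ 2)).
{ apply Rle_mult_inv_pos; [apply pow2_ge_0 |].
  apply Rmult_lt_0_compat; [| apply pow_lt]; lra. }
(* The fifth division is the [slope] term, whose numerator is now 0. *)
unfold Rdiv at 5 in e; rewrite Rmult_0_l, Rmult_0_l in e.
assert (hp' := Rmult_le_pos (p ^ 2) _ (pow2_ge_0 p) hp).
assert (hq' := Rmult_le_pos (q ^ 2) _ (pow2_ge_0 q) hq).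
lra.
Qed.

Lemma V_reduced (m g r I1 I3 alpha gamma lambda D p q z : R) :
  0 < r -> 0 < I1 -> 0 < I3 -> 0 < gamma -> 0 < gamma + alpha ^ 2 - 1 ->
  -1 < z < 1 ->
  p = lambda * (alpha - 1 + gamma)
      - r * D * sqrt (gamma + alpha ^ 2 - 1) * (1 - alpha) ->
  q = lambda * (alpha + 1 - gamma)
      + r * D * sqrt (gamma + alpha ^ 2 - 1) * (1 + alpha) ->
  V m g r I1 I3 alpha gamma z D lambda =
  reduced (beta m g r I3 alpha gamma) p q z
    / (2 * I3 * r ^ 2 * gamma ^ 2 * (gamma + alpha ^ 2 - 1))
  + (m * g * r
     + (r ^ 2 * D ^ 2 * (gamma + alpha ^ 2 - 1) - (1 - gamma) * lambda ^ 2)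
       / (2 * r ^ 2 * I1 * (gamma + alpha ^ 2 - 1))).
Proof.
intros hr hI1 hI3 hga hk hz -> ->.
unfold V, reduced, beta.
(* The identity holds for any number in place of the square root. *)
generalize (sqrt (gamma + alpha ^ 2 - 1)); intro s.
field; repeat split; nra.
Qed.

Lemma V_min_of_root (m g r I1 I3 alpha gamma lambda D p q z : R) :
  0 < r -> 0 < I1 -> 0 < I3 -> 0 < gamma -> 0 < gamma + alpha ^ 2 - 1 ->
  -1 < z < 1 ->
  p = lambda * (alpha - 1 + gamma)
      - r * D * sqrt (gamma + alpha ^ 2 - 1) * (1 - alpha) ->
  q = lambda * (alpha + 1 - gamma)
      + r * D * sqrt (gamma + alpha ^ 2 - 1) * (1 + alpha) ->
  slope (beta m g r I3 alpha gamma) p q z = 0 ->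
  is_minimum_on (fun z => V m g r I1 I3 alpha gamma z D lambda) (-1) 1 z.
Proof.
intros hr hI1 hI3 hga hk hz ep eq h.
split; [exact hz |]; intros w hw.
rewrite (V_reduced _ _ _ _ _ _ _ _ _ p q z) by assumption.
rewrite (V_reduced _ _ _ _ _ _ _ _ _ p q w) by assumption.
apply Rplus_le_compat_r, Rmult_le_compat_r.
- left; apply Rinv_0_lt_compat; repeat apply Rmult_lt_0_compat; nra.
- apply reduced_min; assumption.
Qed.

(** * The threshold inequality, and the sign of [slope] at the inner interval ends *)

Lemma threshold_bound (m g r I3 alpha gamma lambda : R) :
  0 < m -> 0 < g -> 0 < r -> 0 < I3 -> 0 < alpha < 1 ->
  1 - alpha ^ 2 < gamma < 1 ->
  lambda > lambda_thres m g r I3 alpha gamma ->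
  0 < lambda /\
  2 * beta m g r I3 alpha gamma * (1 + alpha) ^ 2
    < alpha ^ 2 * gamma ^ 2 * lambda ^ 2.
Proof.
intros hm hg hr hI3 ha hga hl.
unfold lambda_thres in hl; unfold beta.
set (c := m * g * r ^ 3 * I3 * alpha) in *.
assert (hc : 0 < c) by (unfold c; repeat apply Rmult_lt_0_compat; nra).
assert (hx : 0 < 1 + alpha - gamma) by lra.
set (x := 1 + alpha - gamma) in *.
assert (hsx : 0 < sqrt x) by (apply sqrt_lt_R0; assumption).
assert (hsc : 0 < sqrt c) by (apply sqrt_lt_R0; assumption).
assert (hsx2 : sqrt x * sqrt x = x) by (apply sqrt_sqrt; lra).
assert (hsc2 : sqrt c * sqrt c = c) by (apply sqrt_sqrt; lra).
assert (ht : 0 < sqrt c * (1 + alpha) ^ 2 / sqrt x).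
{ apply Rdiv_lt_0_compat; [| assumption].
  apply Rmult_lt_0_compat; [assumption | apply pow_lt; lra]. }
set (t := sqrt c * (1 + alpha) ^ 2 / sqrt x) in *.
assert (ht2 : t ^ 2 * x = c * (1 + alpha) ^ 4).
{ rewrite <- hsx2 at 1; rewrite <- hsc2; unfold t; field; lra. }
assert (hl2 : t ^ 2 < lambda ^ 2) by nra.
split; [lra |].
assert (hga2 : 0 < gamma ^ 2) by (apply pow_lt; nra).
assert (amgm : 4 * (gamma + alpha ^ 2 - 1) * x <= alpha ^ 2 * (1 + alpha) ^ 2).
{ replace (alpha ^ 2 * (1 + alpha) ^ 2)
    with (4 * (gamma + alpha ^ 2 - 1) * x
          + (gamma + alpha ^ 2 - 1 - x) ^ 2) by (unfold x; ring).
  pose proof (pow2_ge_0 (gamma + alpha ^ 2 - 1 - x)); lra. }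
assert (hcg : 0 < c * (1 + alpha) ^ 2) by nra.
(* Multiply [amgm] by c (1 + alpha)^2, recognise c (1 + alpha)^4 as t^2 x by [ht2], and cancel x. *)
assert (h1 : 4 * c * (gamma + alpha ^ 2 - 1) * (1 + alpha) ^ 2
             <= alpha ^ 2 * t ^ 2).
{ apply Rmult_le_reg_r with x; [assumption |].
  rewrite Rmult_assoc with (r2 := t ^ 2), ht2.
  apply Rmult_le_compat_l with (r := c * (1 + alpha) ^ 2) in amgm; lra. }
assert (h2 : alpha ^ 2 * t ^ 2 < alpha ^ 2 * lambda ^ 2).
{ apply Rmult_lt_compat_l; nra. }
apply Rle_lt_trans
  with (gamma ^ 2 * (4 * c * (gamma + alpha ^ 2 - 1) * (1 + alpha) ^ 2)).
- unfold c; right; ring.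
- replace (alpha ^ 2 * gamma ^ 2 * lambda ^ 2)
    with (gamma ^ 2 * (alpha ^ 2 * lambda ^ 2)) by ring.
  apply Rmult_lt_compat_l; lra.
Qed.

(** Here L stands for alpha gamma lambda, the value at z = alpha of the affine function under the
    square, whatever D is. Hence (1 + a) p + (1 - a) q = 2 L, and q = s d fixes p. As s^2 = 1, the
    sign enters only through s (1 - a) L d, so s = 1 is the worse case and is the one in the
    equation. *)
Lemma slope_left_nonneg (b L a e d s : R) :
  0 < a < 1 -> 0 < e < 1 -> 0 < L -> 0 < d -> s = 1 \/ s = -1 ->
  (1 - a) * L * d + a * d ^ 2 + d ^ 2 / e ^ 2 * (1 - e) * (1 + a) ^ 2
    <= L ^ 2 - b / 2 * (2 - e) ^ 2 * (1 + a) ^ 2 ->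
  0 <= slope b ((2 * L - s * d * (1 - a)) / (1 + a)) (s * d) (-1 + e).
Proof.
intros ha he hL hd hs h.
assert (hLd : 0 <= L * d * (1 - a)).
{ apply Rmult_le_pos; [apply Rmult_le_pos |]; lra. }
assert (hfac : 0 < 4 * e ^ 2 / (1 + a) ^ 2).
{ apply Rdiv_lt_0_compat; nra. }
assert (e1 : slope b ((2 * L - s * d * (1 - a)) / (1 + a)) (s * d) (-1 + e)
  = 4 * e ^ 2 / (1 + a) ^ 2 *
    (L ^ 2 - b / 2 * (2 - e) ^ 2 * (1 + a) ^ 2
     - (s * (1 - a) * L * d + s ^ 2 * (a * d ^ 2)
        + s ^ 2 * (d ^ 2 / e ^ 2 * (1 - e) * (1 + a) ^ 2)))).
{ unfold slope; field; lra. }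
rewrite e1.
apply Rmult_le_pos; [lra |].
destruct hs as [-> | ->]; lra.
Qed.

(** The same relation between p and q, now solved for q with p = s d; again s = 1 is the worse
    sign. *)
Lemma slope_right_nonpos (b L a e d s : R) :
  0 < a < 1 -> 0 < e < 1 -> 0 < L -> 0 < d -> s = 1 \/ s = -1 ->
  d ^ 2 / e ^ 2 * (1 - e) * (1 - a) ^ 2 + L * d * (1 + a) - a * d ^ 2
    <= L ^ 2 + b / 2 * (2 - e) ^ 2 * (1 - a) ^ 2 ->
  slope b (s * d) ((2 * L - s * d * (1 + a)) / (1 - a)) (1 - e) <= 0.
Proof.
intros ha he hL hd hs h.
assert (hLd : 0 <= L * d * (1 + a)).
{ apply Rmult_le_pos; [apply Rmult_le_pos |]; lra. }
assert (hfac : 0 < 4 * e ^ 2 / (1 - a) ^ 2).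
{ apply Rdiv_lt_0_compat; nra. }
assert (e1 : slope b (s * d) ((2 * L - s * d * (1 + a)) / (1 - a)) (1 - e)
  = - (4 * e ^ 2 / (1 - a) ^ 2 *
    (L ^ 2 + b / 2 * (2 - e) ^ 2 * (1 - a) ^ 2
     - (s ^ 2 * (d ^ 2 / e ^ 2 * (1 - e) * (1 - a) ^ 2)
        + s * L * d * (1 + a) - s ^ 2 * (a * d ^ 2))))).
{ unfold slope; field; lra. }
rewrite e1.
apply Ropp_le_cancel; rewrite Ropp_0, Ropp_involutive.
apply Rmult_le_pos; [lra |].
destruct hs as [-> | ->]; lra.
Qed.

(** * Minima near -1 and near 1 *)

Theorem proposition2
  (m g r I1 I3 alpha gamma lambda : R)
  (hm : 0 < m) (hg : 0 < g) (hr : 0 < r) (hI1 : 0 < I1) (hI3 : 0 < I3)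
  (halpha : 0 < alpha < 1)
  (hgamma : gamma = I1 / I3)
  (hgamma_range : 1 - alpha ^ 2 < gamma < 1)
  (hsigma : m * r ^ 2 / I3 = (1 - gamma) / (gamma + alpha ^ 2 - 1))
  (hlambda : lambda > lambda_thres m g r I3 alpha gamma) :
  (exists eps0, 0 < eps0 < 1 /\
    forall eps, 0 < eps < eps0 ->
    exists delta_minus,
      0 < delta_minus /\
      alpha * (1 - alpha) * gamma * lambda * delta_minus
        + alpha * delta_minus ^ 2
        + delta_minus ^ 2 / eps ^ 2 * (1 - eps) * (1 + alpha) ^ 2
      = alpha ^ 2 * gamma ^ 2 * lambda ^ 2
        - beta m g r I3 alpha gamma / 2 * (2 - eps) ^ 2 * (1 + alpha) ^ 2 /\
      forall delta, 0 < delta < delta_minus ->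
      forall D,
        D = D1 r alpha gamma lambda
            + delta / (r * (1 + alpha) * sqrt (gamma + alpha ^ 2 - 1)) \/
        D = D1 r alpha gamma lambda
            - delta / (r * (1 + alpha) * sqrt (gamma + alpha ^ 2 - 1)) ->
      exists zmin,
        -1 <= zmin <= -1 + eps /\
        is_minimum_on (fun z => V m g r I1 I3 alpha gamma z D lambda)
          (-1) 1 zmin)
  /\
  (exists eps0, 0 < eps0 < 1 /\
    forall eps, 0 < eps < eps0 ->
    exists delta1 delta2 delta_plus,
      delta1 = gamma * (1 + alpha) * lambda /\
      unique
        (fun delta =>
           0 < delta /\
           delta ^ 2 / eps ^ 2 * (1 - eps) * (1 - alpha) ^ 2
             + alpha * gamma * lambda * delta * (1 + alpha)
             - alpha * delta ^ 2
           = alpha ^ 2 * gamma ^ 2 * lambda ^ 2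
             + beta m g r I3 alpha gamma / 2 * (2 - eps) ^ 2 * (1 - alpha) ^ 2)
        delta2 /\
      delta_plus = Rmin delta1 delta2 /\
      0 < delta_plus /\
      forall delta, 0 < delta < delta_plus ->
      forall D,
        D = D0 r alpha gamma lambda
            - delta / (r * (1 - alpha) * sqrt (gamma + alpha ^ 2 - 1)) \/
        D = D0 r alpha gamma lambda
            + delta / (r * (1 - alpha) * sqrt (gamma + alpha ^ 2 - 1)) ->
      exists zmin,
        1 - eps <= zmin <= 1 /\
        is_minimum_on (fun z => V m g r I1 I3 alpha gamma z D lambda)
          (-1) 1 zmin).
Proof.
destruct halpha as [ha0 ha1].
assert (hga0 : 0 < gamma) by nra.
assert (hk : 0 < gamma + alpha ^ 2 - 1) by lra.
assert (hs : 0 < sqrt (gamma + alpha ^ 2 - 1)) by (apply sqrt_lt_R0; lra).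
destruct (threshold_bound m g r I3 alpha gamma lambda) as [hl hthr];
  try assumption; [lra |].
assert (hb : 0 < beta m g r I3 alpha gamma).
{ unfold beta; repeat apply Rmult_lt_0_compat; nra. }
pose (L := alpha * gamma * lambda).
assert (hL : 0 < L) by (unfold L; repeat apply Rmult_lt_0_compat; assumption).
pose (b := beta m g r I3 alpha gamma).
fold b in hb, hthr |- *.
split.
(* Any bound in (0, 1) would do: the coefficients below have the right signs for all such e. *)
- exists (1 / 2); split; [lra |]; intros e he.
  set (A := alpha + (1 - e) * (1 + alpha) ^ 2 / e ^ 2).
  assert (hA : 0 < A).
  { apply Rplus_lt_0_compat; [assumption |].
    apply Rdiv_lt_0_compat; [apply Rmult_lt_0_compat |]; nra. }
  assert (hB : 0 <= (1 - alpha) * L) by (apply Rmult_le_pos; lra).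
  (* [hthr] is this claim at e = 0, the worst case because (2 - e)^2 <= 4. *)
  assert (hC : 0 < L ^ 2 - b / 2 * (2 - e) ^ 2 * (1 + alpha) ^ 2).
  { assert (b / 2 * (1 + alpha) ^ 2 * (2 - e) ^ 2
            <= b / 2 * (1 + alpha) ^ 2 * 4).
    { apply Rmult_le_compat_l; nra. }
    unfold L; lra. }
  destruct (pos_quadratic_root A _ _ hA hB hC) as [dm [hdm edm]].
  exists dm; split; [exact hdm |]; split.
  { transitivity (A * dm ^ 2 + (1 - alpha) * L * dm);
      [unfold A, L; field; lra | rewrite edm; unfold L; ring]. }
  intros d hd D hD.
  assert (hdm2 := pos_quadratic_incr A _ d dm hA hB hd).
  assert (hsgn : exists s, (s = 1 \/ s = -1) /\
    D = D1 r alpha gamma lambda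
        + s * (d / (r * (1 + alpha) * sqrt (gamma + alpha ^ 2 - 1)))).
  { destruct hD as [-> | ->]; [exists 1 | exists (-1)]; (split; [lra | ring]). }
  destruct hsgn as [s [hs1 eD]].
  destruct (slope_root_left b ((2 * L - s * d * (1 - alpha)) / (1 + alpha))
              (s * d) e) as [z [hz ez]].
  + lra.
  + destruct hs1 as [-> | ->]; nra.
  + apply slope_left_nonneg; try lra.
    apply Rle_trans with (A * d ^ 2 + (1 - alpha) * L * d);
      [right; unfold A; field; lra | lra].
  + exists z; split; [lra |].
    apply V_min_of_root
      with (p := (2 * L - s * d * (1 - alpha)) / (1 + alpha)) (q := s * d);
      try assumption; [lra | |]; rewrite eD; unfold D1, L; field; lra.
(* This bound makes the leading coefficient [A] positive: alpha e^2 < e < (1 - alpha)^2 / 2 <= (1 -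
   e) (1 - alpha)^2. *)
- exists ((1 - alpha) ^ 2 / 2); split; [nra |]; intros e he.
  assert (he1 : e < 1 / 2) by nra.
  set (A := (1 - e) * (1 - alpha) ^ 2 / e ^ 2 - alpha).
  assert (hA : 0 < A).
  { replace A with (((1 - e) * (1 - alpha) ^ 2 - alpha * e ^ 2) / e ^ 2)
      by (unfold A; field; lra).
    apply Rdiv_lt_0_compat; [| nra].
    assert (alpha * e ^ 2 < e) by nra.
    assert (1 / 2 * (1 - alpha) ^ 2 <= (1 - e) * (1 - alpha) ^ 2).
    { apply Rmult_le_compat_r; nra. }
    lra. }
  assert (hB : 0 <= L * (1 + alpha)) by (apply Rmult_le_pos; lra).
  assert (hC : 0 < L ^ 2 + b / 2 * (2 - e) ^ 2 * (1 - alpha) ^ 2).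
  { apply Rplus_lt_0_compat; [nra |].
    repeat apply Rmult_lt_0_compat; nra. }
  assert (eA : forall d,
    d ^ 2 / e ^ 2 * (1 - e) * (1 - alpha) ^ 2
      + alpha * gamma * lambda * d * (1 + alpha) - alpha * d ^ 2
    = A * d ^ 2 + L * (1 + alpha) * d).
  { intro d; unfold A, L; field; lra. }
  assert (eC : alpha ^ 2 * gamma ^ 2 * lambda ^ 2
               + b / 2 * (2 - e) ^ 2 * (1 - alpha) ^ 2
               = L ^ 2 + b / 2 * (2 - e) ^ 2 * (1 - alpha) ^ 2).
  { unfold L; ring. }
  destruct (pos_quadratic_root A _ _ hA hB hC) as [d2 [hd2 ed2]].
  assert (hd1 : 0 < gamma * (1 + alpha) * lambda).
  { repeat apply Rmult_lt_0_compat; lra. }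
  exists (gamma * (1 + alpha) * lambda), d2,
    (Rmin (gamma * (1 + alpha) * lambda) d2).
  split; [reflexivity |]; split.
  { split.
    - split; [exact hd2 |]; rewrite eA, eC; exact ed2.
    - intros d [hd ed]; rewrite eA, eC, <- ed2 in ed.
      symmetry; exact (pos_quadratic_inj A _ d d2 hA hB hd hd2 ed). }
  split; [reflexivity |].
  split; [apply Rmin_glb_lt; assumption |].
  intros d hd D hD.
  assert (hdd2 : 0 < d < d2).
  { pose proof (Rmin_r (gamma * (1 + alpha) * lambda) d2); lra. }
  assert (hd22 := pos_quadratic_incr A _ d d2 hA hB hdd2).
  (* The minus sign before s makes p = s d, since p decreases in D. *)
  assert (hsgn : exists s, (s = 1 \/ s = -1) /\
    D = D0 r alpha gamma lambda
        - s * (d / (r * (1 - alpha) * sqrt (gamma + alpha ^ 2 - 1)))).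
  { destruct hD as [-> | ->]; [exists 1 | exists (-1)]; (split; [lra | ring]). }
  destruct hsgn as [s [hs1 eD]].
  destruct (slope_root_right b (s * d)
              ((2 * L - s * d * (1 + alpha)) / (1 - alpha)) e) as [z [hz ez]].
  + lra.
  + destruct hs1 as [-> | ->]; nra.
  + apply slope_right_nonpos; try lra.
    specialize (eA d); fold L in eA; rewrite eA; lra.
  + exists z; split; [lra |].
    apply V_min_of_root
      with (p := s * d) (q := (2 * L - s * d * (1 + alpha)) / (1 - alpha));
      try assumption; [lra | |]; rewrite eD; unfold D0, L; field; lra.
Qed.
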